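(* Let $(A,\diamond,\circ,\sigma)$ be a skew truss such that $(A,\circ)$ is a group. Then $A$ is a skew brace with respect to $\diamond$ and the operation $\bullet$ defined by $$a\bullet b = \sigma^{-1}(a)\circ b = a\circ 1_\diamond^\circ\circ b,\qquad\text{for all } a,b\in A$$ (in particular $\sigma$ is bijective and the two expressions for $a\bullet b$ agree).
   Context: A skew (left) truss is a quadruple $(A,\diamond,\circ,\sigma)$ where $(A,\diamond)$ is a group, $(A,\circ)$ is a semigroup and $\sigma:A\to A$ is a function such that for all $a,b,c\in A$, $a\circ(b\diamond c) = (a\circ b)\diamond\sigma(a)^\diamond\diamond(a\circ c)$. Here $1_\diamond$ is the neutral element of $(A,\diamond)$, $a^\diamond$ is the inverse of $a$ in $(A,\diamond)$, and $a^\circ$ is the inverse of $a$ in $(A,\circ)$ when the latter is a group. A skew (left) brace is a set $A$ with two group operations $\diamond$ and $\bullet$ such that for all $a,b,c\in A$, $a\bullet(b\diamond c) = (a\bullet b)\diamond a^\diamond\diamond(a\bullet c)$. *)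

(* Defs.v *)
From mathcomp Require Import ssreflect ssrfun ssrbool.

Set Implicit Arguments.
Unset Strict Implicit.
Unset Printing Implicit Defensive.

(* Trusses and braces put several operations on one carrier, so groups are
   unbundled predicates on operations instead of canonical [groupType]
   instances.  This also avoids the [choiceType] structure that [groupType]
   imposes on the carrier. *)

Record is_group (A : Type) (op : A -> A -> A) (one : A) (inv : A -> A) : Prop :=
  IsGroup {
    group_opA : associative op;
    group_op1x : left_id one op;
    group_opx1 : right_id one op;
    group_opVx : left_inverse one inv op;
    group_opxV : right_inverse one inv op
  }.

Record is_skew_truss (A : Type)
    (dia : A -> A -> A) (one_dia : A) (inv_dia : A -> A)
    (circ : A -> A -> A) (sigma : A -> A) : Prop :=
  IsSkewTruss {
    truss_dia_group : is_group dia one_dia inv_dia;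
    truss_circA : associative circ;
    truss_distr : forall a b c,
      circ a (dia b c) = dia (dia (circ a b) (inv_dia (sigma a))) (circ a c)
  }.

(* The neutral element and the inversion of [bul] do not occur in the brace
   law, hence they are existentially quantified. *)
Record is_skew_brace (A : Type)
    (dia : A -> A -> A) (one_dia : A) (inv_dia : A -> A)
    (bul : A -> A -> A) : Prop :=
  IsSkewBrace {
    brace_dia_group : is_group dia one_dia inv_dia;
    brace_bul_group : exists one_bul inv_bul, is_group bul one_bul inv_bul;
    brace_distr : forall a b c,
      bul a (dia b c) = dia (dia (bul a b) (inv_dia a)) (bul a c)
  }.

(* Main.v *)
(* Taking [b = c = 1_dia] in the truss law gives [sigma a = a o 1_dia], so
   [sigma] is a right translation of the group [(A, o)], inverted by the right
   translation by [inv_circ one_dia].  The operation [a o 1_dia^o o b] is the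
   group law [o] transported along this translation, with neutral element
   [1_dia], and the brace law is the truss law at [sigma^-1 a]. *)
Require Import Defs.
From mathcomp Require Import ssreflect ssrfun ssrbool.

Lemma skew_truss_sigmaE {A : Type} {dia : A -> A -> A} {one_dia : A}
    {inv_dia : A -> A} {circ : A -> A -> A} {sigma : A -> A} :
  is_skew_truss dia one_dia inv_dia circ sigma ->
  forall a, sigma a = circ a one_dia.
Proof.
move=> [[dA d1x dx1 dVx dxV] _ distr] a.
have := distr a one_dia one_dia; rewrite d1x -dA.
(* Left cancellation of a o 1_dia leaves 1_dia = sigma(a)^-1 dia (a o 1_dia). *)
move/(congr1 (dia (inv_dia (circ a one_dia)))); rewrite dA dVx d1x.
by move/(congr1 (dia (sigma a))); rewrite dx1 dA dxV d1x.
Qed.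

(** Right translation by [e] is an isomorphism from [op]: (a e) e^-1 (b e) = (a b) e. Hence the
    inverse of a is (a e^-1)^-1 e = e a^-1 e. *)
Lemma is_group_translate {A : Type} {op : A -> A -> A} {one : A}
    {inv : A -> A} (e : A) :
  is_group op one inv ->
  is_group (fun a b => op (op a (inv e)) b) e (fun a => op (op e (inv a)) e).
Proof.
move=> [opA op1x opx1 opVx opxV]; split.
- by move=> a b c; rewrite !opA.
- by move=> a; rewrite opxV op1x.
- by move=> a; rewrite -opA opVx opx1.
- by move=> a; rewrite -(opA _ e) opxV opx1 -opA opVx opx1.
- by move=> a; rewrite !opA -(opA a) opVx opx1 opxV op1x.
Qed.

Theorem lemma4p3 (A : Type)
    (dia : A -> A -> A) (one_dia : A) (inv_dia : A -> A)
    (circ : A -> A -> A) (one_circ : A) (inv_circ : A -> A)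
    (sigma : A -> A)
    (truss : is_skew_truss dia one_dia inv_dia circ sigma)
    (circ_group : is_group circ one_circ inv_circ) :
  exists sigma_inv : A -> A,
    [/\ cancel sigma sigma_inv,
        cancel sigma_inv sigma,
        forall a b, circ (sigma_inv a) b = circ (circ a (inv_circ one_dia)) b
      & is_skew_brace dia one_dia inv_dia (fun a b => circ (sigma_inv a) b)].
Proof.
have sigmaE := skew_truss_sigmaE truss.
have bul_group := is_group_translate one_dia circ_group.
case: truss => dia_group circA distr; case: circ_group => _ _ cx1 cVx cxV.
have sigma_invK : cancel (fun a => circ a (inv_circ one_dia)) sigma.
  by move=> a; rewrite sigmaE -circA cVx cx1.
(* With this witness the two formulas for the product agree by conversion. *)
exists (fun a => circ a (inv_circ one_dia)); split=> //.
  by move=> a; rewrite sigmaE -circA cxV cx1.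
split=> //.
  by exists one_dia, (fun a => circ (circ one_dia (inv_circ a)) one_dia).
(* [sigma_invK] reduces the middle factor to [inv_dia a]. *)
by move=> a b c; rewrite distr sigma_invK.
Qed.
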